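(* Let $\mathbf{k}$ be a unital commutative ring and let $\Omega=\bigcup_{n\ge 0}\Omega_n$ be a signature with $\Omega_n\neq\emptyset$ for at least one $n>1$. Let $\mathcal{A}$ be a nonzero finite prime $\Omega$-algebra over $\mathbf{k}$. Then $\mathcal{A}$ is critical. In addition, if $\mathcal{A}'$ is a finite $\Omega$-algebra over $\mathbf{k}$ and $\mathcal{A}\in\mathrm{var}(\mathcal{A}')$, then $\mathcal{A}$ is (isomorphic to) a section of $\mathcal{A}'$.
   Context: An $\Omega$-algebra over $\mathbf{k}$ is a $\mathbf{k}$-module $\mathcal{A}$ in which every $\omega\in\Omega_n$ defines a $\mathbf{k}$-multilinear map $\omega:\mathcal{A}^n\to\mathcal{A}$ (for $n=0$, a distinguished element of $\mathcal{A}$). Subalgebras are $\mathbf{k}$-submodules closed under all operations (including containing the distinguished elements); homomorphisms are $\mathbf{k}$-linear maps preserving all operations. An ideal of $\mathcal{A}$ is a $\mathbf{k}$-submodule $I$ such that $\omega(a_1,\dots,a_n)\in I$ for all $n>0$, $\omega\in\Omega_n$, and $a_1,\dots,a_n\in\mathcal{A}$ with at least one $a_i\in I$. The free $\Omega$-algebra $\mathbf{k}_\Omega\langle X\rangle$, $X=\{x_1,x_2,\dots\}$, is the free $\mathbf{k}$-module on the set $M_\Omega(X)$ of monomials, where $M_\Omega(X)$ is the smallest set of formal expressions containing $X$ and $\Omega_0$ and closed under forming $\omega(y_1,\dots,y_n)$ for $\omega\in\Omega_n$. Its elements are called polynomials. A polynomial in given variables is multilinear if each of these variables occurs exactly once in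 each of its monomials. A polynomial $f(x_1,\dots,x_m)$ is a polynomial identity of $\mathcal{A}$ if $f(a_1,\dots,a_m)=0$ for all $a_i\in\mathcal{A}$; $\mathrm{Id}(\mathcal{A})$ is the set of all of them. A variety is the class of all $\Omega$-algebras over $\mathbf{k}$ satisfying some given set of polynomial identities; $\mathrm{var}(\mathcal{A})$ is the variety determined by $\mathrm{Id}(\mathcal{A})$, and the variety generated by a class of algebras is the one determined by all identities common to the class. For nonempty subsets $\mathcal{S}_1,\dots,\mathcal{S}_m\subseteq\mathcal{A}$ ($m\ge2$), $\mathcal{S}_1\cdot\ldots\cdot\mathcal{S}_m$ is the $\mathbf{k}$-span of all elements $f(s_1,\dots,s_m,a_1,\dots,a_t)$ with $t\ge 0$, $f(x_1,\dots,x_{m+t})\in\mathbf{k}_\Omega\langle X\rangle$ multilinear, $s_i\in\mathcal{S}_i$, $a_j\in\mathcal{A}$. The algebra $\mathcal{A}$ is prime if $I\cdot J\neq0$ for every pair of nonzero ideals $I,J$ of $\mathcal{A}$. A section of $\mathcal{A}$ is an algebra $\mathcal{R}/\mathcal{I}$ with $\mathcal{R}\subseteq\mathcal{A}$ a subalgebra and $\mathcal{I}$ an ideal of $\mathcal{R}$; it is proper if $\mathcal{R}\ne\mathcal{A}$ or $\mathcal{I}\neq 0$. An algebra is critical if it does not belong to the variety generated by its proper sections. *)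

(* Defs.v *)
From HB Require Import structures.
From mathcomp Require Import all_boot all_algebra finmap.
From mathcomp Require Import all_classical.
From mathcomp Require Import monalg.

Set Implicit Arguments.
Unset Strict Implicit.
Unset Printing Implicit Defensive.

Import GRing.Theory.

Local Open Scope classical_set_scope.
Local Open Scope ring_scope.

(* A signature is the family Omega : nat -> Type of its sets of n-ary symbols;
   A^n is 'I_n -> A, and dfwith a i x is the n-tuple a with its i-th entry
   replaced by x. For n = 0 multilinearity is void, and omega_op w is a
   distinguished element, since 'I_0 -> A is a singleton. *)
HB.mixin Record isOmegaAlgebra (k : comPzRingType) (Omega : nat -> Type) A
    of GRing.Lmodule k A := {
  omega_op : forall n, Omega n -> ('I_n -> A) -> A;
  omega_op_linear : forall n (w : Omega n) (a : 'I_n -> A) (i : 'I_n),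
    linear (fun x : A => omega_op n w (dfwith a i x))
}.

#[short(type="omegaAlgType")]
HB.structure Definition OmegaAlgebra (k : comPzRingType) (Omega : nat -> Type) :=
  { A of GRing.Lmodule k A & isOmegaAlgebra k Omega A }.

Arguments omega_op {k Omega A n} w a : rename.
Arguments omega_op_linear {k Omega A n} w a i : rename.

Definition omega_hom (k : comPzRingType) (Omega : nat -> Type)
    (A B : omegaAlgType k Omega) (f : A -> B) : Prop :=
  linear f /\
  forall n (w : Omega n) (a : 'I_n -> A), f (omega_op w a) = omega_op w (f \o a).

Definition omega_isomorphic (k : comPzRingType) (Omega : nat -> Type)
    (A B : omegaAlgType k Omega) : Prop :=
  exists f : A -> B, omega_hom f /\ bijective f.

Record subalgebra (k : comPzRingType) (Omega : nat -> Type)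
    (A : omegaAlgType k Omega) := Subalgebra {
  subalg_set :> set A;
  subalg_submod : submod_closed [in subalg_set];
  subalg_op : forall n (w : Omega n) (a : 'I_n -> A),
    (forall i, subalg_set (a i)) -> subalg_set (omega_op w a)
}.

(* An index i : 'I_n with a i in the ideal forces n > 0, so the distinguished
   elements need not belong to an ideal. *)
Record ideal (k : comPzRingType) (Omega : nat -> Type)
    (A : omegaAlgType k Omega) := Ideal {
  ideal_set :> set A;
  ideal_submod : submod_closed [in ideal_set];
  ideal_op : forall n (w : Omega n) (a : 'I_n -> A),
    (exists i, ideal_set (a i)) -> ideal_set (omega_op w a)
}.

Lemma comp_dfwith n (S T : Type) (f : S -> T) (a : 'I_n -> S) (i : 'I_n) (x : S) :
  f \o dfwith a i x = dfwith (f \o a) i (f x).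
Proof.
apply/funext => j /=; case: (dfwithP a x j) => [|j' ij].
  by rewrite dfwithin.
by rewrite dfwithout.
Qed.

Section SubalgebraAlgebra.
Context (k : comPzRingType) (Omega : nat -> Type) (A : omegaAlgType k Omega).
Variable R : subalgebra A.

Definition subalg_pred : {pred A} := [in (R : set A)].

HB.instance Definition _ :=
  GRing.isSubmodClosed.Build k A subalg_pred (subalg_submod R).

Definition subalg : Type := {x : A | x \in subalg_pred}.

HB.instance Definition _ := SubChoice.on subalg.
HB.instance Definition _ := [SubChoice_isSubLmodule of subalg by <:].

Lemma sub_op_subproof n (w : Omega n) (a : 'I_n -> subalg) :
  omega_op w (val \o a) \in subalg_pred.
Proof.
by apply/mem_set/subalg_op => i; apply/set_mem; exact: (valP (a i)).
Qed.

Definition sub_op n (w : Omega n) (a : 'I_n -> subalg) : subalg :=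
  Sub (omega_op w (val \o a)) (sub_op_subproof w a).

Lemma sub_op_linear n (w : Omega n) (a : 'I_n -> subalg) (i : 'I_n) :
  linear (fun x : subalg => sub_op w (dfwith a i x)).
Proof.
move=> c x y; apply: val_inj.
rewrite linearP /= !(comp_dfwith sval) -omega_op_linear.
by rewrite -[sval (c *: x + y)]/(val (c *: x + y)) linearP.
Qed.

HB.instance Definition _ :=
  isOmegaAlgebra.Build k Omega subalg sub_op_linear.

End SubalgebraAlgebra.

Section QuotientAlgebra.
Context (k : comPzRingType) (Omega : nat -> Type) (A : omegaAlgType k Omega).
Variable I : ideal A.
Local Open Scope quotient_scope.

Definition ideal_pred : {pred A} := [in (I : set A)].

HB.instance Definition _ :=
  GRing.isSubmodClosed.Build k A ideal_pred (ideal_submod I).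

Definition quotalg : Type := Quotient.quot ideal_pred.

HB.instance Definition _ := GRing.Zmodule.on quotalg.
HB.instance Definition _ := EqQuotient.on quotalg.

Lemma eq_pi (x y : A) :
  (\pi_quotalg x = \pi_quotalg y) <-> (x - y \in ideal_pred).
Proof.
by split=> [/(@eqquotP _ _ quotalg)|h]; last apply/(@eqquotP _ _ quotalg).
Qed.

Definition quot_scale (c : k) (x : quotalg) : quotalg :=
  \pi_quotalg (c *: repr x).

Lemma pi_scale (c : k) (x : A) :
  quot_scale c (\pi_quotalg x) = \pi_quotalg (c *: x).
Proof.
by apply/eq_pi; rewrite -scalerBr rpredZ //; apply/eq_pi; rewrite reprK.
Qed.

Lemma quot_scaleA (c d : k) (x : quotalg) :
  quot_scale c (quot_scale d x) = quot_scale (c * d) x.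
Proof. by rewrite [LHS]pi_scale scalerA. Qed.

Lemma quot_scale1 : left_id 1 quot_scale.
Proof. by move=> x; rewrite /quot_scale scale1r reprK. Qed.

Lemma quot_scaleDr : right_distributive quot_scale +%R.
Proof.
move=> c; elim/quotW => x; elim/quotW => y.
by rewrite -raddfD !pi_scale -raddfD scalerDr.
Qed.

Lemma quot_scaleDl (x : quotalg) :
  {morph (fun c : k => quot_scale c x) : c d / c + d}.
Proof.
by move=> c d; elim/quotW: x => x; rewrite !pi_scale -raddfD scalerDl.
Qed.

HB.instance Definition _ := GRing.Zmodule_isLmodule.Build k quotalg
  quot_scaleA quot_scale1 quot_scaleDr quot_scaleDl.

Definition quot_op n (w : Omega n) (a : 'I_n -> quotalg) : quotalg :=
  \pi_quotalg (omega_op w (repr \o a)).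

Lemma ideal_op_congr n (w : Omega n) (a b : 'I_n -> A) :
  (forall i, a i - b i \in ideal_pred) ->
  omega_op w a - omega_op w b \in ideal_pred.
Proof.
move=> abI; pose h j (i : 'I_n) := if (i < j)%N then b i else a i.
have -> : a = h 0%N by apply/funext.
suff hI j : (j <= n)%N -> omega_op w (h 0%N) - omega_op w (h j) \in ideal_pred.
  have -> : b = h n by apply/funext => i; rewrite /h ltn_ord.
  exact: hI.
elim: j => [_|j IH jn]; first by rewrite subrr rpred0.
rewrite -(subrK (omega_op w (h j)) (omega_op w (h 0%N))) -addrA.
rewrite rpredD ?IH ?(ltnW jn) //.
pose i := Ordinal jn.
have -> : h j.+1 = dfwith (h j) i (b i).
  apply/funext => l; case: (eqVneq i l) => [<-|il].
    by rewrite dfwithin /h /= ltnSn.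
  rewrite dfwithout // /h ltnS leq_eqVlt.
  case: eqP => // lj; case/eqP: il; apply: val_inj; exact: esym.
have {1}-> : h j = dfwith (h j) i (a i).
  apply/funext => l; case: (eqVneq i l) => [<-|il].
    by rewrite dfwithin /h /= ltnn.
  by rewrite dfwithout.
have /= := omega_op_linear w (h j) i (-1) (b i) (a i).
rewrite !scaleN1r [- b i + _]addrC [- omega_op _ _ + _]addrC => <-.
apply/mem_set/ideal_op; exists i.
by rewrite dfwithin; apply/set_mem/abI.
Qed.

Lemma pi_op n (w : Omega n) (a : 'I_n -> A) :
  quot_op w (\pi_quotalg \o a) = \pi_quotalg (omega_op w a).
Proof.
apply/eq_pi/ideal_op_congr => i /=; apply/eq_pi.
by rewrite reprK.
Qed.

Lemma quot_op_linear n (w : Omega n) (a : 'I_n -> quotalg) (i : 'I_n) :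
  linear (fun x : quotalg => quot_op w (dfwith a i x)).
Proof.
move=> c x y.
have E (z : A) : quot_op w (dfwith a i (\pi_quotalg z)) =
    \pi_quotalg (omega_op w (dfwith (repr \o a) i z)).
  rewrite -pi_op comp_dfwith; congr (quot_op w (dfwith _ _ _)).
  by apply/funext => j /=; rewrite reprK.
have piZD (u v : A) :
    \pi_quotalg (c *: u + v) = c *: \pi_quotalg u + \pi_quotalg v.
  by rewrite raddfD; congr (_ + _); exact/esym/pi_scale.
rewrite -[x]reprK -[y]reprK -piZD !E omega_op_linear.
exact: piZD.
Qed.

HB.instance Definition _ :=
  isOmegaAlgebra.Build k Omega quotalg quot_op_linear.

End QuotientAlgebra.

Definition section (k : comPzRingType) (Omega : nat -> Type)
    (A : omegaAlgType k Omega) (R : subalgebra A)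
    (I : ideal (subalg R : omegaAlgType k Omega)) : omegaAlgType k Omega :=
  quotalg I.

Definition proper_section (k : comPzRingType) (Omega : nat -> Type)
    (A B : omegaAlgType k Omega) : Prop :=
  exists (R : subalgebra A) (I : ideal (subalg R : omegaAlgType k Omega)),
    ((R : set A) <> [set: A] \/ (I : set (subalg R)) <> [set 0]) /\
    B = section I.

(* The free generators are indexed from 0. *)
Inductive monomial (Omega : nat -> Type) : Type :=
| Var of nat
| App n (w : Omega n) of 'I_n -> monomial Omega.

Arguments Var {Omega} i.
Arguments App {Omega n} w ms.

HB.instance Definition _ (Omega : nat -> Type) := gen_eqMixin (monomial Omega).
HB.instance Definition _ (Omega : nat -> Type) := gen_choiceMixin (monomial Omega).

(* Finitely supported coefficient functions on the monomials. *)
Notation polynomial k Omega := {malg k[monomial Omega]}.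

Fixpoint occ (Omega : nat -> Type) (i : nat) (m : monomial Omega) : nat :=
  match m with
  | Var j => (i == j)
  | App n w ms => (\sum_(j < n) occ i (ms j))%N
  end.

(* f is a polynomial in the variables x_0, ..., x_(n-1) only, and is
   multilinear in these variables. *)
Definition multilinear (k : comPzRingType) (Omega : nat -> Type) (n : nat)
    (f : polynomial k Omega) : Prop :=
  forall m, m \in msupp f -> forall i, occ i m = (i < n)%N :> nat.

Section Evaluation.
Context (k : comPzRingType) (Omega : nat -> Type) (A : omegaAlgType k Omega).

Fixpoint meval (a : nat -> A) (m : monomial Omega) : A :=
  match m with
  | Var i => a i
  | App n w ms => omega_op w (fun j => meval a (ms j))
  end.

(* The variables not occurring in f do not affect the value f(a_0, a_1, ...). *)
Definition peval (a : nat -> A) (f : polynomial k Omega) : A :=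
  \sum_(m <- msupp f) f@_m *: meval a m.

Definition identities : set (polynomial k Omega) :=
  [set f | forall a : nat -> A, peval a f = 0].

End Evaluation.

(* Classes of algebras are predicates: they live in too high a universe to be
   of type set (omegaAlgType k Omega). *)
Section Varieties.
Context (k : comPzRingType) (Omega : nat -> Type).

Definition variety (F : set (polynomial k Omega)) (B : omegaAlgType k Omega) :
    Prop :=
  F `<=` identities B.

Definition var (A : omegaAlgType k Omega) : omegaAlgType k Omega -> Prop :=
  variety (identities A).

Definition generated_variety (C : omegaAlgType k Omega -> Prop) :
    omegaAlgType k Omega -> Prop :=
  variety [set f | forall B, C B -> identities B f].

Definition critical (A : omegaAlgType k Omega) : Prop :=
  ~ generated_variety (proper_section A) A.

End Varieties.

Definition kspan (k : comPzRingType) (V : lmodType k) (S : set V) : set V :=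
  [set x | exists n (c : 'I_n -> k) (s : 'I_n -> V),
    (forall i, S (s i)) /\ x = \sum_(i < n) c i *: s i].

(* The product S_1 . ... . S_m of the subsets listed in Ss; the variables
   x_0, ..., x_(m-1) of f take values in S_1, ..., S_m respectively and the t
   remaining ones range over A. *)
Definition subset_prod (k : comPzRingType) (Omega : nat -> Type)
    (A : omegaAlgType k Omega) (Ss : seq (set A)) : set A :=
  kspan [set x | exists t (f : polynomial k Omega) (a : nat -> A),
    [/\ multilinear (size Ss + t) f,
        forall i, (i < size Ss)%N -> nth set0 Ss i (a i)
      & x = peval a f]].

Definition prime_algebra (k : comPzRingType) (Omega : nat -> Type)
    (A : omegaAlgType k Omega) : Prop :=
  forall I J : ideal A, (I : set A) <> [set 0] -> (J : set A) <> [set 0] ->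
    subset_prod [:: (I : set A); (J : set A)] <> [set 0].

(* Main.v *)
(* Call the polynomials vanishing under a family of evaluations a vanishing
   set; their images under a surjective evaluation e in A are ideals of A. If f1
   and f2 lie in vanishing sets L1 and L2 and have nonzero values at e, primeness
   gives a multilinear h(x_0, x_1, ...) with h(p_0, p_1, ...) nonzero at e, where
   p_0 is in L1 and p_1 in L2; since h is multilinear, h(p_0, p_1, ...) is in both
   L1 and L2. So a finite intersection of kernels of evaluations is contained
   in ker e only if one of them is. When A lies in the variety generated by
   sections of a finite algebra, evaluations in those sections that take
   finitely many variables into account have finitely many kernels, and some
   ker b is contained in ker e; then A is a quotient of the subalgebra generated
   by the values of b. For a proper section of A this is impossible by counting. *)

Require Import Defs.
From HB Require Import structures.
From mathcomp Require Import all_boot all_algebra finmap.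
From mathcomp Require Import all_classical.
From mathcomp Require Import monalg.

Set Implicit Arguments.
Unset Strict Implicit.
Unset Printing Implicit Defensive.

Import GRing.Theory.

Local Open Scope classical_set_scope.
Local Open Scope ring_scope.

(** * Polynomials as functions on all algebras: linearity, operations, substitution *)

Section PolynomialEvaluation.
Context (k : comPzRingType) (Omega : nat -> Type).
Local Notation pol := {malg k[monomial Omega]}.
Implicit Types (A B : omegaAlgType k Omega) (f g : pol).

Lemma omega_op0 A n (w : Omega n) (a : 'I_n -> A) i : a i = 0 -> omega_op w a = 0.
Proof.
move=> ai0; have -> : a = dfwith a i 0.
  apply/funext => j; case: (eqVneq i j) => [<-|ij]; first by rewrite dfwithin.
  by rewrite dfwithout.
have := omega_op_linear w a i 1 0 0; rewrite !scale1r addr0.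
by move=> /(congr1 (+%R^~ (- omega_op w (dfwith a i 0)))); rewrite addrK subrr.
Qed.

Lemma peval_fset A (a : nat -> A) f (D : {fset monomial Omega}) :
  (msupp f `<=` D)%fset -> peval a f = \sum_(m <- D) f@_m *: meval a m.
Proof.
move=> fD; apply: big_fset_incl => // m _ mf.
by rewrite mcoeff_outdom // scale0r.
Qed.

Lemma peval_is_zmod_morphism A (a : nat -> A) : zmod_morphism (peval a).
Proof.
move=> f g; pose D := (msupp f `|` msupp g)%fset.
rewrite !(@peval_fset A a _ D) ?fsubsetUl ?fsubsetUr ?msuppB_le //.
by rewrite -sumrB; apply: eq_bigr => m _; rewrite mcoeffB scalerBl.
Qed.

HB.instance Definition _ A (a : nat -> A) :=
  GRing.isZmodMorphism.Build pol A (peval a)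
    (peval_is_zmod_morphism a).

Lemma pevalU A (a : nat -> A) c m : peval a << c *g m >> = c *: meval a m.
Proof.
by rewrite (peval_fset a (msuppU_le (x := c))) big_seq_fset1 mcoeffUU.
Qed.

Lemma peval_var A (a : nat -> A) i : peval a << Var i >> = a i.
Proof. by rewrite pevalU scale1r. Qed.

(* {malg k[_]} is an lmodType only for nontrivial k, which is not assumed. *)
Definition pscale (c : k) f : pol :=
  \sum_(m <- msupp f) << c * f@_m *g m >>.

Lemma pevalZ A (a : nat -> A) c f : peval a (pscale c f) = c *: peval a f.
Proof.
rewrite raddf_sum scaler_sumr; apply: eq_bigr => m _.
by rewrite /= pevalU scalerA.
Qed.

(** This stands in for the operations of the free algebra. The polynomial [g] is specified only by
    its values, uniformly in all algebras, and comes from expanding [w] multilinearly. *)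
Lemma omega_op_polynomial n (w : Omega n) (fs : 'I_n -> pol) :
  exists g, forall A (a : nat -> A),
    peval a g = omega_op w (fun i => peval a (fs i)).
Proof.
(* Induction on [j], where only the first [j] arguments may fail to be monomials; [j = n] is no
   restriction. *)
suff: forall j, (j <= n)%N -> forall fs : 'I_n -> pol,
    (forall i : 'I_n, (j <= i)%N -> exists m, fs i = << m >>) ->
    exists g, forall A (a : nat -> A),
      peval a g = omega_op w (fun i => peval a (fs i)).
  by move/(_ n (leqnn n)); apply=> i; rewrite leqNgt ltn_ord.
elim=> [_|j IH jn] {}fs fsU.
  have [ms msE] := choice (fun i => fsU i isT).
  exists << App w ms >> => A a; rewrite pevalU scale1r /=.
  by congr (omega_op w _); apply/funext => i; rewrite msE pevalU scale1r.
pose i := Ordinal jn.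
(* Replacing argument [i] by a single monomial [m] leaves a case covered by the induction
   hypothesis; linearity in argument [i] then recombines the monomials of [fs i]. *)
have /choice[g gE] m : exists g, forall A (a : nat -> A), peval a g =
    omega_op w (dfwith (fun i => peval a (fs i)) i (meval a m)).
  have [|g gE] := IH (ltnW jn) (dfwith fs i << m >>).
    move=> l jl; case: (eqVneq i l) => [<-|il]; first by exists m; rewrite dfwithin.
    rewrite dfwithout //; apply: fsU; rewrite ltn_neqAle jl andbT.
    by apply: contraNneq il => jl'; apply/eqP/val_inj.
  exists g => A a; rewrite gE.
  rewrite -[fun _ => _]/(peval a \o dfwith fs i << m >>) comp_dfwith.
  by rewrite pevalU scale1r.
exists (\sum_(m <- msupp (fs i)) pscale (fs i)@_m (g m)) => A a.
pose h x := omega_op w (dfwith (fun i => peval a (fs i)) i x).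
have hL : linear h by exact: omega_op_linear.
have -> : (fun i => peval a (fs i)) =
    dfwith (fun i => peval a (fs i)) i (peval a (fs i)).
  apply/funext => l; case: (eqVneq i l) => [<-|il]; first by rewrite dfwithin.
  by rewrite dfwithout.
rewrite -/(h _) raddf_sum /= /(peval a (fs i)).
have h0 : h 0 = 0 by apply: (@omega_op0 _ _ _ _ i); rewrite dfwithin.
elim: (enum_fset (msupp (fs i))) => [|m s IHs].
  by rewrite !big_nil h0.
by rewrite !big_cons hL -IHs pevalZ gE.
Qed.

Lemma subst_polynomial f (p : nat -> pol) :
  exists g, forall A (a : nat -> A),
    peval a g = peval (fun i => peval a (p i)) f.
Proof.
have /choice[g gE] m : exists g, forall A (a : nat -> A),
    peval a g = meval (fun i => peval a (p i)) m.
  elim: m => [i|n w ms /choice[fs fsE]]; first by exists (p i).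
  have [g gE] := omega_op_polynomial w fs; exists g => A a; rewrite gE /=.
  by congr (omega_op w _); apply/funext => i; rewrite fsE.
exists (\sum_(m <- msupp f) pscale f@_m (g m)) => A a.
by rewrite raddf_sum; apply: eq_bigr => m _; rewrite /= pevalZ gE.
Qed.

Lemma meval_occ0 A (a : nat -> A) i m :
  a i = 0 -> (0 < occ i m)%N -> meval a m = 0.
Proof.
move=> ai0; elim: m => [j|n w ms IH] /=; first by case: eqP => [<-|].
rewrite lt0n sum_nat_eq0 => /forallPn[j]; rewrite implyTb -lt0n => /IH.
exact: omega_op0.
Qed.

Lemma peval_multilinear0 A (a : nat -> A) i n f :
  multilinear n f -> (i < n)%N -> a i = 0 -> peval a f = 0.
Proof.
move=> fM lt_in ai0; rewrite /peval big_seq big1 // => m mf.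
by rewrite (meval_occ0 ai0) ?scaler0 // (fM m mf) lt_in.
Qed.

(* The intersections of kernels of evaluations play the role of the ideals of
   the free algebra. *)
Definition vanishing (D : forall B, (nat -> B) -> Prop) : set (pol) :=
  [set f | forall B (b : nat -> B), D B b -> peval b f = 0].

(** * Primeness of the kernel of a surjective evaluation *)

Section VanishingImage.
Variables (A : omegaAlgType k Omega) (e : nat -> A).
Hypothesis e_surj : forall x, exists i, e i = x.
Variable D : forall B, (nat -> B) -> Prop.

Definition vanishing_image : set A := peval e @` vanishing D.

Lemma vanishing_image_submod : submod_closed [in vanishing_image].
Proof.
split; first by apply/mem_set; exists 0; [move=> B b _|]; exact: raddf0.
move=> c x y /set_mem[f fD <-] /set_mem[g gD <-].
apply/mem_set; exists (pscale c f + g); last by rewrite raddfD /= pevalZ.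
by move=> B b Db; rewrite raddfD /= pevalZ (fD B b Db) (gD B b Db) scaler0 addr0.
Qed.

Lemma vanishing_image_op n (w : Omega n) (a : 'I_n -> A) :
  (exists i, vanishing_image (a i)) -> vanishing_image (omega_op w a).
Proof.
move=> [i [f fD fE]].
(* The entry in the image is lifted to [f] itself, not to just any polynomial with the same value,
   so that the result vanishes on [D]; the other entries are lifted to variables. *)
have /choice[fs fsE] j : exists g, peval e g = a j /\ (j = i -> g = f).
  case: (eqVneq j i) => [->|ji]; first by exists f.
  have [l el] := e_surj (a j); exists << Var l >>; rewrite peval_var.
  by split=> // /eqP; rewrite (negPf ji).
have [g gE] := omega_op_polynomial w fs; exists g.
  move=> B b Db; rewrite gE; apply: (@omega_op0 _ _ _ _ i).
  by rewrite (fsE i).2 // (fD B b Db).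
by rewrite gE; congr (omega_op w _); apply/funext => j; rewrite (fsE j).1.
Qed.

Definition vanishing_ideal : ideal A :=
  Ideal vanishing_image_submod vanishing_image_op.

End VanishingImage.

Lemma prime_vanishing2 A (e : nat -> A) (D1 D2 : forall B, (nat -> B) -> Prop) f1 f2 :
  prime_algebra A -> (forall x, exists i, e i = x) ->
  vanishing D1 f1 -> vanishing D2 f2 -> peval e f1 <> 0 -> peval e f2 <> 0 ->
  exists g, [/\ vanishing D1 g, vanishing D2 g & peval e g <> 0].
Proof.
move=> primeA e_surj f1D f2D f1e f2e.
have nz D f : vanishing D f -> peval e f <> 0 ->
    (vanishing_ideal e_surj D : set A) <> [set 0].
  move=> fD fe /seteqP[/(_ (peval e f)) + _]; apply: contra_not fe; apply.
  by exists f.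
apply: contrapT => noG.
apply: (primeA _ _ (nz _ _ f1D f1e) (nz _ _ f2D f2e)).
(* Without such a [g], every generator of the product of the two image ideals is shown to be zero,
   against primeness. *)
apply/seteqP; split=> [_ [n [c [s [sP ->]]]]|_ ->]; last first.
  exists 0%N, (fun=> 0), (fun=> 0); rewrite big_ord0.
  by split=> // -[].
rewrite /= big1 // => i _; suff -> : s i = 0 by rewrite scaler0.
have [t [f [a [fM aP ->]]]] := sP i; apply: contrapT => fa.
have [g0 g0D g0E] := aP 0%N isT; have [g1 g1D g1E] := aP 1%N isT.
(* The first two arguments lift to the vanishing sets of [D1] and [D2], the remaining ones to
   variables. *)
have /choice[p pE] j : exists g,
    [/\ peval e g = a j, j = 0%N -> g = g0 & j = 1%N -> g = g1].
  case: j => [|[|j]]; [by exists g0|by exists g1|].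
  by have [l el] := e_surj (a j.+2); exists << Var l >>; rewrite peval_var.
have [g gE] := subst_polynomial f p; case: noG; exists g; split.
- move=> B b Db; rewrite gE (@peval_multilinear0 _ _ 0%N _ _ fM) //.
  by case: (pE 0%N) => _ -> // _; exact: g0D.
- move=> B b Db; rewrite gE (@peval_multilinear0 _ _ 1%N _ _ fM) //.
  by case: (pE 1%N) => _ _ -> //; exact: g1D.
rewrite gE; congr (peval _ f <> 0): fa; apply/funext => j.
by case: (pE j).
Qed.

Lemma prime_vanishing_seq A (e : nat -> A) (I : eqType) (s : seq I)
    (D : I -> forall B, (nat -> B) -> Prop) :
  prime_algebra A -> (forall x, exists i, e i = x) -> (exists x : A, x <> 0) ->
  (forall i, exists2 f, vanishing (D i) f & peval e f <> 0) ->
  exists2 f, (forall i, i \in s -> vanishing (D i) f) & peval e f <> 0.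
Proof.
move=> primeA e_surj [x x0] De.
(* Merging the families indexed by [s] into one lets each induction step be a single use of
   [prime_vanishing2]. *)
suff [f fD fe] : exists2 f,
    vanishing (fun B b => exists2 i, i \in s & D i B b) f & peval e f <> 0.
  by exists f => // i si B b Db; apply: fD; exists i.
elim: s => [|i s [f fD fe]].
  (* Every polynomial vanishes on the empty family, so a variable with nonzero value suffices. *)
  have [l el] := e_surj x; exists << Var l >>; last by rewrite peval_var el.
  by move=> B b [].
have [g gD ge] := De i.
have [h [hD1 hD2 he]] := prime_vanishing2 primeA e_surj fD gD fe ge.
exists h => // B b [j]; rewrite inE => /predU1P[-> Db|sj Db]; first exact: hD2.
by apply: hD1; exists j.
Qed.

(** * Finitely many kernels of evaluations *)

Lemma finite_surj (V : zmodType) :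
  finite_set [set: V] -> exists n (d : 'I_n.+1 -> V), forall x, exists i, d i = x.
Proof.
(* The extra index [size s] takes the default value 0 and makes the index type nonempty, as [inord]
   requires. *)
move=> /finite_seqP[s sE]; exists (size s), (fun i => nth 0 s i) => x.
have xs : x \in s by have : [set: V] x by []; rewrite sE.
by exists (inord (index x s)); rewrite inordK ?nth_index // ltnS index_size.
Qed.

(* [u] chooses representatives in A' of the elements of B, and [Z] is the set
   of representatives of 0. *)
Definition coordinatized (A' B : omegaAlgType k Omega) : Prop :=
  exists (u : B -> A') (Z : set A'), forall (b : nat -> B) f,
    peval b f = 0 <-> Z (peval (u \o b) f).

(** Otherwise each of the finitely many possible kernels contains a polynomial nonzero in [A].
    Primeness gives one lying in all of them, and identifying variables turns it into an identity of
    [C] that fails in [A]. *)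
Lemma prime_generated A A' (C : omegaAlgType k Omega -> Prop) :
  prime_algebra A -> finite_set [set: A] -> (exists x : A, x <> 0) ->
  finite_set [set: A'] -> (forall B, C B -> coordinatized A' B) ->
  generated_variety C A ->
  exists B (b : nat -> B) (e : nat -> A),
    [/\ C B, forall x, exists i, e i = x
      & forall f, peval b f = 0 -> peval e f = 0].
Proof.
move=> primeA /finite_surj[n [e e_surj]] A_neq0 /finite_surj[m [d d_surj]] CA' CA.
(* Evaluations through [r] depend on the first [n.+1] variables only, as larger indices are sent to
   0. *)
pose r : nat -> 'I_n.+1 := inord.
have er_surj x : exists i, e (r i) = x.
  by have [i <-] := e_surj x; exists i; rewrite /r inord_val.
apply: contrapT => noB.
(* Up to the enumeration d of A', the kernel of b \o r is determined by the
   finite data cS. *)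
pose D (cS : {ffun 'I_n.+1 -> 'I_m.+1} * {set 'I_m.+1}) B (b : nat -> B) :=
  C B /\ forall f, peval b f = 0 <->
    exists2 i, i \in cS.2 & d i = peval (d \o cS.1 \o r) f.
have [|f fD fe] := prime_vanishing_seq
    (enum {: {ffun 'I_n.+1 -> 'I_m.+1} * {set 'I_m.+1}})
    (D := D) primeA er_surj A_neq0.
  (* All evaluations in [D cS] have the same kernel, so one of them decides; if there is none, any
     polynomial vanishes. *)
  move=> cS; have [[B [b [CB bcS]]]|noD] := pselect (exists B b, D cS B b).
    apply: contrapT => noF; apply: noB; exists B, b, (e \o r); split => // f fb.
    apply: contrapT => fe; apply: noF; exists f => // B' b' [_ b'cS].
    exact/b'cS/bcS.
  have [x x0] := A_neq0; have [l el] := er_surj x.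
  exists << Var l >>; last by rewrite peval_var el.
  by move=> B b Db; case: noD; exists B, b.
(* Vanishing of [f] at all [b \o r] becomes vanishing of [g] at all [b]. *)
have [g gE] := subst_polynomial f (fun i => << Var (r i) >>).
have gV B (b : nat -> B) : peval b g = peval (b \o r) f.
  by rewrite gE; congr (peval _ f); apply/funext => i; rewrite peval_var.
(* Since [r] is idempotent, [f] and [g] agree at [e \o r]. *)
apply: fe; have <- : peval (e \o r) g = peval (e \o r) f.
  by rewrite gV; congr (peval _ f); apply/funext => i; rewrite /= /r inord_val.
apply: CA => B CB b; rewrite gV.
have [u [Z uZ]] := CA' _ CB.
(* The data of [b \o r]: indices in [d] of the representatives of its values, and the set [Z] pulled
   back along [d]. *)
have /choice[c cE] (i : 'I_n.+1) := d_surj (u (b i)).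
pose S := [set i : 'I_m.+1 | `[< Z (d i) >]]%SET.
apply: (fD (finfun c, S)); first by rewrite mem_enum.
split=> // h; rewrite uZ.
have -> : u \o (b \o r) = d \o finfun c \o r.
  by apply/funext => i /=; rewrite ffunE cE.
split=> [Zh|[i]]; last by rewrite inE => /asboolP Zi <-.
have [i di] := d_surj (peval (d \o finfun c \o r) h).
by exists i; rewrite // inE; apply/asboolP; rewrite di.
Qed.

(** * Homomorphisms and coordinates on sections *)

Lemma coordinatized_refl A : coordinatized A A.
Proof. by exists id, [set 0]. Qed.

Lemma omega_hom_meval A B (h : A -> B) (a : nat -> A) m :
  omega_hom h -> meval (h \o a) m = h (meval a m).
Proof.
move=> [_ hop]; elim: m => [//|n w ms IH] /=.
by rewrite hop; congr (omega_op w _); apply/funext => i /=.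
Qed.

Lemma omega_hom0 A B (h : A -> B) : omega_hom h -> h 0 = 0.
Proof.
move=> [hL _]; have := hL 1 0 0; rewrite !scale1r addr0.
by move=> /(congr1 (+%R^~ (- h 0))); rewrite addrK subrr.
Qed.

Lemma omega_hom_peval A B (h : A -> B) (a : nat -> A) f :
  omega_hom h -> peval (h \o a) f = h (peval a f).
Proof.
move=> hH; rewrite /peval; elim: (enum_fset (msupp f)) => [|m s IH].
  by rewrite !big_nil omega_hom0.
by rewrite !big_cons IH omega_hom_meval // hH.1.
Qed.

Lemma val_omega_hom A (R : subalgebra A) : omega_hom (val : subalg R -> A).
Proof. by split=> // c x y; rewrite linearP. Qed.

Lemma pi_omega_hom A (I : ideal A) :
  omega_hom (\pi_(quotalg I)%qT : A -> quotalg I).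
Proof.
split=> [c x y|n w a]; last by rewrite -pi_op.
by rewrite raddfD; congr (_ + _); exact/esym/pi_scale.
Qed.

(** The map [repr] need not be a homomorphism, but [repr \o b] is an evaluation in [R] whose values
    project to those of [b]. So [f] vanishes at [b] exactly when its lifted value lies in [I]. *)
Lemma coordinatized_section A (R : subalgebra A)
    (I : ideal (subalg R : omegaAlgType k Omega)) : coordinatized A (section I).
Proof.
exists (val \o repr : section I -> A), (val @` (I : set (subalg R))) => b f.
rewrite -compA (omega_hom_peval _ _ (val_omega_hom R)).
have {1}-> : b = \pi_(quotalg I)%qT \o (repr \o b).
  by apply/funext => i /=; rewrite reprK.
rewrite (omega_hom_peval _ _ (pi_omega_hom I)).
rewrite -(omega_hom0 (pi_omega_hom I)) eq_pi subr0.
split=> [/set_mem If|[x Ix /val_inj <-]]; last exact/mem_set.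
by exists (peval (repr \o b) f).
Qed.

(** * The subalgebra generated by the values of an evaluation, and its quotient *)

Section GeneratedSubalgebra.
Variables (B : omegaAlgType k Omega) (b : nat -> B).

Lemma range_peval_submod : submod_closed [in range (peval b)].
Proof.
split; first by apply/mem_set; exists 0; rewrite ?raddf0.
move=> c x y /set_mem[f _ <-] /set_mem[g _ <-]; apply/mem_set.
by exists (pscale c f + g); rewrite // raddfD /= pevalZ.
Qed.

Lemma range_peval_op n (w : Omega n) (a : 'I_n -> B) :
  (forall i, range (peval b) (a i)) -> range (peval b) (omega_op w a).
Proof.
move=> /(_ _)/cid2-/all_sig2[f _ fE]; have [g gE] := omega_op_polynomial w f.
by exists g; rewrite // gE; congr (omega_op w _); apply/funext.
Qed.

Definition generated_subalgebra : subalgebra B :=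
  Subalgebra range_peval_submod range_peval_op.

Lemma generated_subalgebraP (x : subalg generated_subalgebra) :
  exists f, peval b f = val x.
Proof. by have /set_mem[f _ <-] := valP x; exists f. Qed.

Lemma peval_generated f : peval b f \in subalg_pred generated_subalgebra.
Proof. by apply/mem_set; exists f. Qed.

Variables (A : omegaAlgType k Omega) (e : nat -> A).
Hypothesis e_surj : forall x, exists i, e i = x.
Hypothesis ker_be : forall f, peval b f = 0 -> peval e f = 0.

(** This is the kernel of the map sending the value of [f] at [b] to its value at [e], which
    [ker_be] makes well defined. *)
Definition generated_kernel : set (subalg generated_subalgebra) :=
  [set x | forall f, peval b f = val x -> peval e f = 0].

Lemma peval_eq f g : peval b f = peval b g -> peval e f = peval e g.
Proof.
by move=> fg; apply/subr0_eq; rewrite -raddfB; apply: ker_be; rewrite raddfB /= fg subrr.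
Qed.

Lemma generated_kernelP x f :
  peval b f = val x -> generated_kernel x <-> peval e f = 0.
Proof.
by move=> fx; split=> [/(_ f)|fe g gx]; [exact|rewrite -fe; apply: peval_eq; rewrite gx].
Qed.

Lemma generated_kernel_submod : submod_closed [in generated_kernel].
Proof.
split; first by apply/mem_set/(@generated_kernelP _ 0); rewrite raddf0.
move=> c x y /set_mem xK /set_mem yK; apply/mem_set.
have [f fx] := generated_subalgebraP x; have [g gy] := generated_subalgebraP y.
apply/(@generated_kernelP _ (pscale c f + g)).
  by rewrite raddfD /= pevalZ fx gy; exact/esym/(val_omega_hom _).1.
by rewrite raddfD /= pevalZ xK // yK // scaler0 addr0.
Qed.

Lemma generated_kernel_op n (w : Omega n) (a : 'I_n -> subalg generated_subalgebra) :
  (exists i, generated_kernel (a i)) -> generated_kernel (omega_op w a).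
Proof.
move=> [i iK]; have /choice[f fE] j := generated_subalgebraP (a j).
have [g gE] := omega_op_polynomial w f; apply/(@generated_kernelP _ g).
  by rewrite gE /=; congr (omega_op w _); apply/funext => j; rewrite fE.
by rewrite gE; apply: (@omega_op0 _ _ _ _ i); exact/iK/fE.
Qed.

Definition generated_ideal : ideal (subalg generated_subalgebra : omegaAlgType k Omega) :=
  Ideal generated_kernel_submod generated_kernel_op.

(** Both sides are the polynomials modulo the kernel of [e]: by [qE], classes in the section agree
    exactly when values at [e] do. *)
Lemma isomorphic_generated_section : omega_isomorphic A (section generated_ideal).
Proof.
pose q f : section generated_ideal :=
  (\pi_(quotalg generated_ideal) (Sub (peval b f) (peval_generated f)))%qT.
have qE f g : q f = q g <-> peval e f = peval e g.
  rewrite /q eq_pi; split=> [/set_mem fg|fg].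
    apply/subr0_eq; rewrite -raddfB; apply/(generated_kernelP _).1/fg.
    by rewrite raddfB.
  apply/mem_set/(@generated_kernelP _ (f - g)); first by rewrite raddfB.
  by rewrite raddfB /= fg subrr.
have /choice[v vE] x : exists f, peval e f = x.
  by have [l <-] := e_surj x; exists << Var l >>; rewrite peval_var.
have qvE f : q (v (peval e f)) = q f by apply/qE; rewrite vE.
exists (q \o v); split; last first.
  have /choice[h hE] (y : section generated_ideal) : exists f, q f = y.
    elim/quotW: y => y; have [f fy] := generated_subalgebraP y; exists f.
    by congr (\pi_(quotalg _) _)%qT; apply: val_inj.
  exists (fun y => peval e (h y)) => [x|y] /=; last by rewrite qvE hE.
  by rewrite -[RHS]vE; apply/qE; rewrite hE.
split=> [c x y|n w a] /=.
  have -> : c *: x + y = peval e (pscale c (v x) + v y).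
    by rewrite raddfD /= pevalZ !vE.
  rewrite qvE -(pi_omega_hom generated_ideal).1.
  by congr (\pi_(quotalg _) _)%qT; apply: val_inj; rewrite (val_omega_hom _).1 /= raddfD /= pevalZ.
have [g gE] := omega_op_polynomial w (v \o a).
have -> : omega_op w a = peval e g.
  by rewrite gE; congr (omega_op w _); apply/funext => j /=; rewrite vE.
rewrite qvE -[(q \o v) \o a]/(\pi_(quotalg generated_ideal)%qT \o
  (fun j => Sub (peval b (v (a j))) (peval_generated (v (a j))))).
rewrite -(pi_omega_hom generated_ideal).2.
by congr (\pi_(quotalg _) _)%qT; apply: val_inj; rewrite /= gE.
Qed.

End GeneratedSubalgebra.

(** * Exclusion of proper sections by counting, and the theorem *)

Lemma finite_inj_surj (V : zmodType) (v : V -> V) :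
  finite_set [set: V] -> injective v -> forall x, exists y, v y = x.
Proof.
move=> /finite_seqP[s0 s0E] v_inj x; pose s := undup s0.
have sT y : y \in s by rewrite mem_undup; have : [set: V] y by []; rewrite s0E.
have [||_ vs] := @uniq_min_size _ (map v s) s _ (fun y _ => sT y).
- by rewrite map_inj_uniq // undup_uniq.
- by rewrite size_map.
by have /mapP[y _ ->] : x \in map v s; [rewrite vs|exists y].
Qed.

(** An inclusion of kernels would inject [A] into the section, hence by representatives into [A]
    itself. By finiteness this injection is onto, which forces [R] to be all of [A] and [I] to be
    zero. *)
Lemma proper_section_kernel A B (b : nat -> B) (e : nat -> A) :
  finite_set [set: A] -> proper_section A B -> (forall x, exists i, e i = x) ->
  ~ (forall f, peval b f = 0 -> peval e f = 0).
Proof.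
move=> A_fin [R [I [RI BE]]] e_surj ker_be; move: b ker_be; rewrite {B}BE => b ker_be.
have /choice[v vE] x : exists f, peval e f = x.
  by have [l <-] := e_surj x; exists << Var l >>; rewrite peval_var.
pose g x := val (repr (peval b (v x) : section I)) : A.
have g_inj : injective g.
  move=> x y /val_inj/(can_inj reprK) xy.
  by rewrite -(vE x) -(vE y); apply: peval_eq ker_be _ _ xy.
have g_surj := finite_inj_surj A_fin g_inj.
case: RI; apply.
  by apply/seteqP; split=> // x _; have [y <-] := g_surj x; exact/set_mem/valP.
(* Every element of [R] is the chosen representative of its class, so the classes modulo [I] are
   singletons. *)
have piK (x : subalg R) : repr (\pi_(quotalg I) x)%qT = x.
  by have [y /val_inj <-] := g_surj (val x); rewrite reprK.
apply/seteqP; split=> [x Ix|_ ->]; last by apply/set_mem; exact: (ideal_submod I).1.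
rewrite /= -(piK x) -[RHS]piK; congr (repr _).
by apply/eq_pi; rewrite subr0; exact/mem_set.
Qed.

End PolynomialEvaluation.

Theorem theorem8 (k : comPzRingType) (Omega : nat -> Type)
    (hOmega : exists n : nat, (1 < n)%N /\ inhabited (Omega n))
    (A : omegaAlgType k Omega)
    (A_nonzero : exists a : A, a <> 0)
    (A_finite : finite_set [set: A])
    (A_prime : prime_algebra A) :
  critical A /\
  (forall A' : omegaAlgType k Omega,
     finite_set [set: A'] -> var A' A ->
     exists (R : subalgebra A') (I : ideal (subalg R : omegaAlgType k Omega)),
       omega_isomorphic A (section I)).
Proof.
split=> [A_gen|A' A'_finite A_var].
  have [|B [b [e [AB e_surj ker_be]]]] :=
    prime_generated A_prime A_finite A_nonzero A_finite _ A_gen.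
    by move=> B [R [I [_ ->]]]; exact: coordinatized_section.
  exact: proper_section_kernel A_finite AB e_surj ker_be.
(* The variety of [A'] is the one generated by the class consisting of [A'] alone. *)
have [|f fA'|B [b [e [BA' e_surj ker_be]]]] :=
    @prime_generated _ _ A A' (fun B => B = A') A_prime A_finite A_nonzero A'_finite.
- by move=> B ->; exact: coordinatized_refl.
- by apply: A_var; exact: fA'.
move: b ker_be; rewrite BA' => b ker_be.
by do 2!eexists; exact: isomorphic_generated_section e_surj ker_be.
Qed.
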